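(* Let $p,m,n\in\mathbb{N}_0$ with $p\le m\le n$ and let $k\in\{0,\ldots,p+m+n\}$. Then the quantities $\mathsf{F}_{k,p,m,n}$ (the integrals of products of four Hermite polynomials) satisfy $$\mathsf{F}_{k,p,m+1,n}-\mathsf{F}_{k,p+1,m,n}+2m\,\mathsf{F}_{k,p,m-1,n}-2p\,\mathsf{F}_{k,p-1,m,n}=0,$$ $$\mathsf{F}_{k,p,m,n+1}-\mathsf{F}_{k,p+1,m,n}+2n\,\mathsf{F}_{k,p,m,n-1}-2p\,\mathsf{F}_{k,p-1,m,n}=0,$$ $$\mathsf{F}_{k+1,p,m,n}-\mathsf{F}_{k,p+1,m,n}+2k\,\mathsf{F}_{k-1,p,m,n}-2p\,\mathsf{F}_{k,p-1,m,n}=0,$$ $$\mathsf{F}_{k,p,m,n+1}-\mathsf{F}_{k,p,m+1,n}+2n\,\mathsf{F}_{k,p,m,n-1}-2m\,\mathsf{F}_{k,p,m-1,n}=0,$$ $$\mathsf{F}_{k+1,p,m,n}-\mathsf{F}_{k,p,m+1,n}+2k\,\mathsf{F}_{k-1,p,m,n}-2m\,\mathsf{F}_{k,p,m-1,n}=0,$$ $$\mathsf{F}_{k+1,p,m,n}-\mathsf{F}_{k,p,m,n+1}+2k\,\mathsf{F}_{k-1,p,m,n}-2n\,\mathsf{F}_{k,p,m,n-1}=0.$$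
   Context: $\mathbb{N}_0=\{0,1,2,\ldots\}$; $(z)_j=z(z+1)\cdots(z+j-1)$; ${}_4F_3\!\left({a_1,\ldots,a_4\atop b_1,b_2,b_3};x\right)=\sum_{j\ge0}\frac{(a_1)_j\cdots(a_4)_j}{(b_1)_j(b_2)_j(b_3)_j}\frac{x^j}{j!}$, where a series having upper parameters in $\{0,-1,-2,\ldots\}$ is summed only for $0\le j\le J$, with $J$ the smallest nonnegative integer such that $-J$ is an upper parameter. The reciprocal of the factorial of a negative integer is $0$ (and then the whole expression containing it is $0$). For $k,p,m,n\in\mathbb{N}_0$: $\mathsf{F}_{k,p,m,n}=0$ if $k+p+m+n$ is odd; if $k+p+m+n$ is even, $\mathsf{F}_{k,p,m,n}=\mathsf{E}_{k,p,m,n}$ for $0\le k\le m+n-p$, $\mathsf{F}_{k,p,m,n}=\mathsf{D}_{k,p,m,n}$ for $m+n-p+2\le k\le m+n+p$, and $\mathsf{F}_{k,p,m,n}=0$ otherwise, where $$\mathsf{E}_{k,p,m,n}=\frac{\sqrt\pi\,m!\,n!\,(p+k)!\,2^{\lfloor\frac{k+p+m+n}2\rfloor}}{\lfloor\frac{m+n-p-k}2\rfloor!\,\lfloor\frac{k+p+n-m}2\rfloor!\,\lfloor\frac{k+p+m-n}2\rfloor!}\;{}_4F_3\!\left({-k,\,-p,\,\lfloor\frac{n-m-p-k}2\rfloor,\,\lfloor\frac{m-n-p-k}2\rfloor\atop 1+\lfloor\frac{m+n-p-k}2\rfloor,\,\frac{-k-p}2,\,\frac{1-k-p}2};\frac14\right),$$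 $$\mathsf{D}_{k,p,m,n}=\frac{\sqrt\pi\,k!\,p!\,(m+n)!\,2^{\lfloor\frac{p+k+m+n}2\rfloor}}{\lfloor\frac{k+p-m-n}2\rfloor!\,\lfloor\frac{m+n+p-k}2\rfloor!\,\lfloor\frac{m+n+k-p}2\rfloor!}\;{}_4F_3\!\left({-m,\,-n,\,\lfloor\frac{p-k-m-n}2\rfloor,\,\lfloor\frac{k-p-m-n}2\rfloor\atop 1+\lfloor\frac{p+k-m-n}2\rfloor,\,\frac{-m-n}2,\,\frac{1-m-n}2};\frac14\right).$$ These quantities represent $\int_{-\infty}^\infty H_k(x)H_p(x)H_m(x)H_n(x)e^{-x^2}\,dx$, with $H_n$ the (physicists') Hermite polynomials. $\mathsf{F}_{k,p,m,n}:=0$ if one of the indices equals $-1$. *)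

(* Defs.v *)
From mathcomp Require Import all_boot all_order all_algebra.
From mathcomp Require Import all_classical all_reals all_analysis.

Set Implicit Arguments.
Unset Strict Implicit.
Unset Printing Implicit Defensive.

Import Order.TTheory GRing.Theory Num.Theory.
Import numFieldNormedType.Exports.

Local Open Scope ring_scope.

Section Defs.
Variable R : realType.

Definition pochhammer (z : R) (j : nat) : R := \prod_(i < j) (z + i%:R).

Definition hyper_term (a b : seq R) (x : R) (j : nat) : R :=
  (\prod_(c <- a) pochhammer c j) / (\prod_(c <- b) pochhammer c j)
  * (x ^+ j / j`!%:R).

(* When some upper parameter is a nonpositive integer, the series stops at the
   smallest J such that -J is an upper parameter, even if a lower parameter is
   a smaller or equal nonpositive integer. *)
Definition hyper (a b : seq R) (x : R) : R :=
  match pselect (exists J : nat, - J%:R \in a) with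
  | left ex => \sum_(0 <= j < (ex_minn ex).+1) hyper_term a b x j
  | right _ => limn (series (hyper_term a b x))
  end.

Definition hyper4F3 (a1 a2 a3 a4 b1 b2 b3 x : R) : R :=
  hyper [:: a1; a2; a3; a4] [:: b1; b2; b3] x.

(* 1 / z!, equal to 0 when z is a negative integer *)
Definition invfact (z : int) : R := if z is Posz i then (i`!%:R)^-1 else 0.

(* floor (z / 2); intdiv rounds down, also for negative z *)
Definition halfz (z : int) : int := (z %/ 2)%Z.

Definition E4 (k p m n : nat) : R :=
  let k' := k%:Z in let p' := p%:Z in let m' := m%:Z in let n' := n%:Z in
  Num.sqrt pi * m`!%:R * n`!%:R * (p + k)`!%:R * 2 ^+ ((k + p + m + n) %/ 2)
  * invfact (halfz (m' + n' - p' - k'))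
  * invfact (halfz (k' + p' + n' - m'))
  * invfact (halfz (k' + p' + m' - n'))
  * hyper4F3 (- k%:R) (- p%:R)
      (halfz (n' - m' - p' - k'))%:~R (halfz (m' - n' - p' - k'))%:~R
      (1 + (halfz (m' + n' - p' - k'))%:~R)
      ((- k%:R - p%:R) / 2) ((1 - k%:R - p%:R) / 2)
      (1 / 4).

Definition D4 (k p m n : nat) : R :=
  let k' := k%:Z in let p' := p%:Z in let m' := m%:Z in let n' := n%:Z in
  Num.sqrt pi * k`!%:R * p`!%:R * (m + n)`!%:R * 2 ^+ ((p + k + m + n) %/ 2)
  * invfact (halfz (k' + p' - m' - n'))
  * invfact (halfz (m' + n' + p' - k'))
  * invfact (halfz (m' + n' + k' - p'))
  * hyper4F3 (- m%:R) (- n%:R)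
      (halfz (p' - k' - m' - n'))%:~R (halfz (k' - p' - m' - n'))%:~R
      (1 + (halfz (p' + k' - m' - n'))%:~R)
      ((- m%:R - n%:R) / 2) ((1 - m%:R - n%:R) / 2)
      (1 / 4).

Definition F4nat (k p m n : nat) : R :=
  let k' := k%:Z in let p' := p%:Z in let m' := m%:Z in let n' := n%:Z in
  if odd (k + p + m + n) then 0
  else if k' <= m' + n' - p' then E4 k p m n
  else if (m' + n' - p' + 2 <= k') && (k' <= m' + n' + p') then D4 k p m n
  else 0.

(* Integer indices, so that the index -1 makes sense. *)
Definition F4 (k p m n : int) : R :=
  match k, p, m, n with
  | Posz k, Posz p, Posz m, Posz n => F4nat k p m n
  | _, _, _, _ => 0
  end.

End Defs.

(* Main.v *)
(* Write [L f] for the integral of [f(x) exp(-x^2)] divided by [sqrt pi], for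
   [f] a polynomial; all one needs about it is [2 L(x f) = L(f')].  The
   raising operator [f |-> 2 x f - f'] maps [H_n] to [H_(n+1)], whence
   [H_k H_p = sum_i 2^i i! C(k,i) C(p,i) H_(k+p-2i)] and the orthogonality of
   the [H_n].  Linearizing both [H_k H_p] and [H_m H_n] leaves a single sum,
   which agrees term by term with [E] when [k + p <= m + n] and, exchanging the
   two pairs, with [D] otherwise.  So [F] is the integral of the four Hermite
   polynomials for all indices, and each of the six relations says that two
   expressions for the integral of [2 x H_k H_p H_m H_n] given by
   [H_(j+1) + 2 j H_(j-1) = 2 x H_j] coincide. *)

Require Import Defs.
From HB Require Import structures.
From mathcomp Require Import all_boot all_order all_algebra.
From mathcomp Require Import all_classical all_reals all_analysis.
From mathcomp Require Import zify ring lra.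

Import Order.TTheory GRing.Theory Num.Theory.
Local Open Scope ring_scope.

(** * The Gaussian functional and the Hermite polynomials *)

Section Hermite.
Variable R : numFieldType.
Implicit Types (f g : {poly R}) (i j k m n p : nat).

Fixpoint hermite n : {poly R} :=
  if n is n'.+1 then 2%:R *: ('X * hermite n') - (hermite n')^`() else 1.

(* [moment n] is the integral of [x^n exp(-x^2)] divided by [sqrt pi]. *)
Fixpoint moment n : R :=
  match n with
  | 0 => 1
  | 1 => 0
  | n'.+2 => n'.+1%:R / 2%:R * moment n'
  end.

Definition gauss f : R := \sum_(i < size f) f`_i * moment i.

(** Gives polynomials of different sizes a common summation range, as linearity requires. *)
Lemma gauss_wide N f : (size f <= N)%N -> gauss f = \sum_(i < N) f`_i * moment i.
Proof.
move=> le_fN; rewrite /gauss (big_ord_widen _ (fun i => f`_i * moment i) le_fN).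
rewrite big_mkcond; apply: eq_bigr => i _.
by case: ltnP => // le_fi; rewrite nth_default ?mul0r.
Qed.

Lemma gauss_is_linear : linear_for *%R gauss.
Proof.
move=> a f g.
have le_fg : (size (a *: f + g)%R <= maxn (size f) (size g))%N.
  rewrite (leq_trans (size_polyD _ _)) // geq_max leq_maxr.
  by rewrite (leq_trans (size_scale_leq _ _)) ?leq_maxl.
rewrite (gauss_wide _ _ le_fg) (gauss_wide _ f (leq_maxl _ (size g))).
rewrite (gauss_wide _ g (leq_maxr (size f) _)) mulr_sumr -big_split /=.
by apply: eq_bigr => i _; rewrite coefD coefZ mulrDl mulrA.
Qed.

HB.instance Definition _ :=
  GRing.isLinear.Build R {poly R} R *%R gauss gauss_is_linear.

Lemma gauss1 : gauss 1 = 1.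
Proof. by rewrite /gauss size_poly1 big_ord1 coef1 mul1r. Qed.

(** Integration by parts against [exp(-x^2)]; on coefficients it is the recursion of [moment]. *)
Lemma gaussXM f : 2%:R * gauss ('X * f) = gauss f^`().
Proof.
have le_Xf : (size ('X * f)%R <= (size f).+2)%N.
  by rewrite (leq_trans (size_polyMleq _ _)) // size_polyX.
have le_f' : (size f^`() <= size f)%N by exact: leq_trans (size_poly _ _) (leq_pred _).
rewrite (gauss_wide _ _ le_Xf) (gauss_wide _ _ le_f') mulr_sumr.
(* The two lowest terms vanish: ['X * f] has no constant term, and [moment 1 = 0]. *)
rewrite !big_ord_recl /= !coefXM /= mul0r !mulr0 !add0r.
apply: eq_bigr => i _; rewrite coefXM coef_deriv /= /bump /= !add1n -mulr_natr.
by field.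
Qed.

Lemma hermiteS n :
  hermite n.+1 = 2%:R *: ('X * hermite n) - (hermite n)^`().
Proof. by []. Qed.

Lemma deriv_one : (1 : {poly R})^`() = 0.
Proof. by rewrite -polyC1 derivC. Qed.

(** The commutator of differentiation with the raising operator is multiplication by 2, so each
    raising adds 2 to the factor. *)
Lemma deriv_hermiteS n :
  (hermite n.+1)^`() = (2 * n.+1)%:R *: hermite n.
Proof.
elim: n => [|n IHn].
  by rewrite /= mulr1 deriv_one subr0 derivZ derivX muln1.
rewrite hermiteS derivB derivZ derivM derivX mul1r IHn derivZ (hermiteS n).
rewrite -!mul_polyC !rmorph_nat; ring.
Qed.

Lemma deriv_hermite n : (hermite n)^`() = (2 * n)%:R *: hermite n.-1.
Proof. by case: n => [|n]; rewrite ?deriv_hermiteS //= deriv_one muln0 scale0r. Qed.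

Lemma hermite_recurrence n :
  hermite n.+1 + (2 * n)%:R *: hermite n.-1 = 2%:R *: ('X * hermite n).
Proof. by rewrite hermiteS deriv_hermite subrK. Qed.

(** * Linearization of products and orthogonality *)

Definition linearization k p i : R := (2 ^ i * i`! * 'C(k, i) * 'C(p, i))%:R.

Lemma linearization0 k p : linearization k p 0 = 1.
Proof. by rewrite /linearization !bin0. Qed.

Lemma linearization_small k p i :
  (k < i)%N || (p < i)%N -> linearization k p i = 0.
Proof.
by rewrite /linearization; case/orP => /bin_small->; rewrite ?muln0 ?mul0n.
Qed.

(** Pascal's rule for ['C(p.+1, i.+1)], then [i.+1 * 'C(k, i.+1) = k * 'C(k.-1, i)] in the extra
    term. *)
Lemma linearizationSS k p i :
  linearization k p.+1 i.+1 =
  linearization k p i.+1 + (2 * k)%:R * linearization k.-1 p i.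
Proof.
rewrite /linearization -natrM -natrD; congr (_%:R).
case: k => [|k]; first by rewrite !bin0n !muln0 !mul0n.
have := mul_bin_diag k.+1 i; rewrite (binS p) /= factS expnS => E.
have: ((2 ^ i * 2 * i`! * 'C(p, i)) * (i.+1 * 'C(k.+1, i.+1)) =
  (2 ^ i * 2 * i`! * 'C(p, i)) * (k.+1 * 'C(k, i)))%N by rewrite -E.
nia.
Qed.

Lemma hermite_linearization k p :
  hermite k * hermite p =
  \sum_(i < p.+1) linearization k p i *: hermite (k + p - 2 * i).
Proof.
elim: p k => [|p IHp] k.
  by rewrite big_ord1 linearization0 scale1r /= mulr1 muln0 addn0 subn0.
(* the product rule, with the raising operator acting on [H_k H_p] *)
have raise : hermite k * hermite p.+1 =
    2%:R *: ('X * (hermite k * hermite p)) - (hermite k * hermite p)^`()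
    + (2 * k)%:R *: (hermite k.-1 * hermite p).
  rewrite hermiteS derivM (deriv_hermite k) -!mul_polyC; ring.
rewrite raise !IHp.
have -> :
   2%:R *: ('X * \sum_(i < p.+1) linearization k p i *: hermite (k + p - 2 * i))
   - (\sum_(i < p.+1) linearization k p i *: hermite (k + p - 2 * i))^`() =
   \sum_(i < p.+2) linearization k p i *: hermite (k + p.+1 - 2 * i).
  rewrite [RHS]big_ord_recr /= [linearization k p p.+1]linearization_small ?ltnSn ?orbT//.
  rewrite scale0r addr0 mulr_sumr scaler_sumr raddf_sum -sumrB.
  apply: eq_bigr => i _ /=; rewrite derivZ.
  (* For [i <= k] the index is not truncated and is raised by one; for [i > k] the coefficient is
     0. *)
  have [le_ik|lt_ki] := leqP i k; last first.
    by rewrite linearization_small ?lt_ki// !scale0r mulr0 scaler0 subr0.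
  have -> : (k + p.+1 - 2 * i = (k + p - 2 * i).+1)%N by have := ltn_ord i; lia.
  by rewrite hermiteS scalerBr -!scalerAr !scalerA mulrC.
rewrite [RHS]big_ord_recl [X in X + _]big_ord_recl /= !linearization0 -addrA.
congr (_ + _).
rewrite scaler_sumr -big_split; apply: eq_bigr => i _ /=.
rewrite /bump /= !add1n linearizationSS scalerDl scalerA; congr (_ + _).
case: k {raise IHp} => [|k]; first by rewrite muln0 !mul0r !scale0r.
by congr (_ *: hermite _); lia.
Qed.

(** Differentiation is adjoint to the raising operator, by integration by parts. *)
Lemma gaussM_hermiteS f n :
  gauss (f * hermite n.+1) = gauss (f^`() * hermite n).
Proof.
have -> : f * hermite n.+1 =
    2%:R *: ('X * (f * hermite n)) - f * (hermite n)^`().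
  by rewrite hermiteS -!mul_polyC; ring.
by rewrite linearB linearZ /= gaussXM derivM linearD /= addrK.
Qed.

Lemma hermite_orthogonal m n :
  gauss (hermite m * hermite n) = (m == n)%:R * (2 ^ n * n`!)%:R.
Proof.
elim: n m => [|n IHn] m.
  rewrite /= mulr1; case: m => [|m]; first by rewrite gauss1 mul1r.
  by rewrite -[hermite _]mul1r gaussM_hermiteS deriv_one mul0r linear0 mul0r.
rewrite gaussM_hermiteS; case: m => [|m]; first by rewrite /= deriv_one mul0r linear0 mul0r.
rewrite deriv_hermiteS -scalerAl linearZ /= IHn eqSS.
have [->|] := eqVneq; last by rewrite !mul0r mulr0.
by rewrite !mul1r -natrM factS expnS; congr (_%:R); lia.
Qed.

(** * Integrals of four Hermite polynomials as finite sums *)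

Definition gauss4 k p m n : R :=
  gauss (hermite k * hermite p * (hermite m * hermite n)).

Lemma gauss4_sum k p m n :
  gauss4 k p m n = \sum_(i < p.+1) \sum_(j < n.+1)
    linearization k p i * linearization m n j *
    ((k + p - 2 * i == m + n - 2 * j)%N%:R *
     (2 ^ (k + p - 2 * i) * (k + p - 2 * i)`!)%:R).
Proof.
rewrite /gauss4 !hermite_linearization mulr_suml linear_sum.
apply: eq_bigr => i _; rewrite mulr_sumr linear_sum; apply: eq_bigr => j _ /=.
rewrite -scalerAl -scalerAr !linearZ /= hermite_orthogonal mulrA.
by have [->|] := eqVneq; rewrite ?mul0r.
Qed.

(** Where no subtraction truncates, the two indices have opposite parity; elsewhere a coefficient is
    0. *)
Lemma gauss4_odd k p m n : odd (k + p + m + n) -> gauss4 k p m n = 0.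
Proof.
move=> odd_s; rewrite gauss4_sum big1 // => i _; rewrite big1 // => j _.
have [lt_ki|le_ik] := ltnP k i.
  by rewrite linearization_small ?lt_ki ?mul0r.
have [lt_mj|le_jm] := ltnP m j.
  by rewrite [linearization m _ _]linearization_small ?lt_mj// mulr0 mul0r.
case: eqP => [|_]; last by rewrite mul0r mulr0.
by have := ltn_ord i; have := ltn_ord j; lia.
Qed.

(** Orthogonality forces [k + p - 2 * i = m + n - 2 * j], so only [j = i + d] survives. *)
Lemma gauss4_even k p m n d : (m + n = k + p + 2 * d)%N ->
  gauss4 k p m n = \sum_(i < p.+1)
    linearization k p i * linearization m n (i + d) *
    (2 ^ (k + p - 2 * i) * (k + p - 2 * i)`!)%:R.
Proof.
move=> def_d; rewrite gauss4_sum; apply: eq_bigr => i _.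
have [lt_ki|le_ik] := ltnP k i.
  rewrite [linearization k _ _]linearization_small ?lt_ki// !mul0r big1 // => j _.
  by rewrite !mul0r.
have le_ip := ltn_ord i; rewrite ltnS in le_ip.
(* Here [j = i + d] falls outside the inner sum, and the right-hand term is 0 too. *)
have [lt_n|le_n] := ltnP n (i + d).
  rewrite [linearization m _ (i + d)]linearization_small ?lt_n ?orbT// mulr0 mul0r.
  rewrite big1 // => j _; have le_jn := ltn_ord j.
  have [lt_mj|le_jm] := ltnP m j.
    by rewrite [linearization m _ _]linearization_small ?lt_mj// mulr0 mul0r.
  by case: eqP => [|_]; rewrite ?mul0r ?mulr0//; lia.
rewrite (bigD1 (Ordinal (n:=n.+1) (m:=i + d) le_n)) //= big1 => [|j ne_j].
  by rewrite addr0; case: eqP => [_|]; [rewrite mul1r | lia].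
have [lt_mj|le_jm] := ltnP m j.
  by rewrite [linearization m _ _]linearization_small ?lt_mj// mulr0 mul0r.
have le_jn := ltn_ord j.
have {}ne_j : (j : nat) <> (i + d)%N by move=> Ej; case/eqP: ne_j; exact: val_inj.
by case: eqP => [|_]; rewrite ?mul0r ?mulr0//; lia.
Qed.

Lemma gauss4C k p m n : gauss4 k p m n = gauss4 m n k p.
Proof. by rewrite /gauss4 mulrC. Qed.

End Hermite.

Lemma bin_factR (R : numFieldType) m n :
  'C(m + n, m)%:R = (m + n)`!%:R / (m`!%:R * n`!%:R) :> R.
Proof.
have := bin_fact (leq_addr n m); rewrite addKn => <-.
by rewrite -natrM natrM mulfK// pnatr_eq0 -lt0n muln_gt0 !fact_gt0.
Qed.

Lemma ffact_factR (R : numFieldType) m n :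
  ((m + n) ^_ m)%:R = (m + n)`!%:R / n`!%:R :> R.
Proof.
have := ffact_fact (leq_addr n m); rewrite addKn => <-.
by rewrite natrM mulfK// pnatr_eq0 -lt0n fact_gt0.
Qed.

(** * Terminating hypergeometric series *)

Section Hypergeometric.
Variable R : realType.
Implicit Types (x : R) (a b : seq R) (j k m n p N : nat).

Lemma pochhammerS (z : R) j : pochhammer z j.+1 = pochhammer z j * (z + j%:R).
Proof. exact: big_ord_recr. Qed.

Lemma pochhammerN n j :
  pochhammer (- n%:R : R) j = (-1) ^+ j * (n ^_ j)%:R.
Proof.
elim: j => [|j IHj]; first by rewrite /pochhammer big_ord0 expr0 mul1r.
rewrite pochhammerS IHj ffactnSr natrM exprS.
have [le_jn|lt_nj] := leqP j n; last by rewrite ffact_small// !(mulr0, mul0r).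
by rewrite natrB//; ring.
Qed.

Lemma pochhammer1D n j :
  pochhammer (1 + n%:R : R) j = (j + n)`!%:R / n`!%:R.
Proof.
have nz : n`!%:R != 0 :> R by rewrite pnatr_eq0 -lt0n fact_gt0.
elim: j => [|j IHj]; first by rewrite /pochhammer big_ord0 divff.
by rewrite pochhammerS IHj addSn factS natrM -addn1 !natrD; field.
Qed.

(** Duplication formula, for the two lower parameters of the series that differ by 1/2. *)
Lemma pochhammer_double (z : R) j :
  pochhammer (z / 2) j * pochhammer ((1 + z) / 2) j =
  pochhammer z (2 * j) / 4 ^+ j.
Proof.
elim: j => [|j IHj]; first by rewrite /pochhammer !big_ord0 expr0 divr1 mulr1.
rewrite mulnSr addn2 !pochhammerS exprS mulrACA IHj -!natr1 natrM.
by field; rewrite expf_neq0 // pnatr_eq0.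
Qed.

(** The series is cut at the smallest [J], but the terms with [J < j <= N] contain the factor
    [(-J)_j = 0]. *)
Lemma hyper_terminating a b x N : - N%:R \in a ->
  hyper a b x = \sum_(j < N.+1) hyper_term a b x j.
Proof.
move=> aN; rewrite /hyper; case: pselect => [ex|]; last by case; exists N.
case: ex_minnP => J aJ /(_ _ aN) le_JN.
rewrite -(big_mkord predT (hyper_term a b x)) [RHS](big_cat_nat (n := J.+1))//=.
rewrite [X in _ = _ + X]big_nat [X in _ = _ + X]big1 ?addr0// => j /andP[lt_Jj _].
rewrite /hyper_term (perm_big _ (perm_to_rem aJ)) big_cons /= pochhammerN.
by rewrite ffact_small// !(mulr0, mul0r).
Qed.

(* [d], [u], [v] are the three factorial arguments in the denominator of [E],
   so that [m = d + v] and [n = d + u]. *)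
Lemma E4_summand (k p d u v i : nat) : (k + p = u + v)%N -> (i <= p)%N ->
  (d + v)`!%:R * (d + u)`!%:R * (p + k)`!%:R * 2 ^+ (u + v + d)
  * (d`!%:R)^-1 * (u`!%:R)^-1 * (v`!%:R)^-1 *
  hyper_term [:: - k%:R; - p%:R; - v%:R; - u%:R]
    [:: 1 + d%:R; (- k%:R - p%:R) / 2; (1 - k%:R - p%:R) / 2] (1 / 4) i =
  linearization R k p i * linearization R (d + v) (d + u) (i + d) *
    (2 ^ (k + p - 2 * i) * (k + p - 2 * i)`!)%:R.
Proof.
move=> kpuv le_ip.
rewrite /hyper_term /linearization !big_cons !big_nil !mulr1 !pochhammerN.
(* Duplication with [z = -(k + p)] produces a power of 4 that cancels the one from the argument
   1/4. *)
have -> : - k%:R - p%:R = - (k + p)%:R :> R by rewrite natrD opprD.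
have -> : 1 - k%:R - p%:R = 1 + - (k + p)%:R :> R by rewrite natrD opprD addrA.
rewrite pochhammer_double pochhammerN pochhammer1D exprM sqrrN !expr1n mul1r.
(* If [i] exceeds [k], [v] or [u], a falling factorial on the left and a binomial on the right
   vanish. *)
have [lt_ki|le_ik] := ltnP k i.
  by rewrite ffact_small// bin_small// !(mulr0, mul0r, muln0, mul0n).
have [lt_vi|le_iv] := ltnP v i.
  rewrite (ffact_small lt_vi) (bin_small (_ : d + v < i + d)%N); last by lia.
  by rewrite !(mulr0, mul0r, muln0, mul0n).
have [lt_ui|le_iu] := ltnP u i.
  rewrite (ffact_small lt_ui) (bin_small (_ : d + u < i + d)%N); last by lia.
  by rewrite !(mulr0, mul0r, muln0, mul0n).
have -> : (d + v = i + d + (v - i))%N by lia.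
have -> : (d + u = i + d + (u - i))%N by lia.
have -> : (u + v + d = i + (i + d) + (k + p - 2 * i))%N by lia.
have -> : (p + k = k + p)%N by lia.
move: (subnKC le_ik) (subnKC le_ip) (subnKC le_iv) (subnKC le_iu).
(* Naming all differences leaves only factorials of sums, which are nonzero atoms for [field]. *)
have le2 : (2 * i <= k + p)%N by lia.
move: (subnKC le2).
move: (k + p - 2 * i)%N (k - i)%N (p - i)%N (v - i)%N (u - i)%N => q k1 p1 v1 u1.
move=> <- <- <- <- <-.
rewrite !natrM !bin_factR !ffact_factR !natrX !exprD -(signr_odd R i) expr_div_n expr1n.
have fnz n : n`!%:R != 0 :> R by rewrite pnatr_eq0 -lt0n fact_gt0.
have nz4 : 4 ^+ i != 0 :> R by rewrite expf_neq0 // pnatr_eq0.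
(* The four signs [(-1)^i] of the upper parameters cancel for either parity. *)
by case: (odd i); rewrite ?expr0 ?expr1; field; rewrite !fnz nz4.
Qed.

(** * Identification of [F] with the integral *)

(** With [2 * d = m + n - k - p] the floored halves are [d], [n - d], [m - d]. If one of the last
    two is negative both sides are 0; otherwise the sums agree term by term. *)
Lemma E4_gauss4 k p m n : ~~ odd (k + p + m + n) -> (k + p <= m + n)%N ->
  E4 R k p m n = Num.sqrt pi * gauss4 R k p m n.
Proof.
move=> even_s le_kp.
have [d def_d] : exists d, (m + n = k + p + 2 * d)%N.
  by exists ((m + n - (k + p)) %/ 2)%N; lia.
rewrite (gauss4_even R k p m n d def_d) /E4 /hyper4F3 /halfz.
have -> : ((m%:Z + n%:Z - p%:Z - k%:Z) %/ 2)%Z = d by lia.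
have -> : ((k%:Z + p%:Z + n%:Z - m%:Z) %/ 2)%Z = n%:Z - d%:Z by lia.
have -> : ((k%:Z + p%:Z + m%:Z - n%:Z) %/ 2)%Z = m%:Z - d%:Z by lia.
have -> : ((n%:Z - m%:Z - p%:Z - k%:Z) %/ 2)%Z = - (m%:Z - d%:Z) by lia.
have -> : ((m%:Z - n%:Z - p%:Z - k%:Z) %/ 2)%Z = - (n%:Z - d%:Z) by lia.
have invfact_neg (a b : nat) : (a < b)%N -> invfact R (a%:Z - b%:Z) = 0.
  by move=> lt_ab; have -> : a%:Z - b%:Z = Negz (b - a).-1 by lia.
have [lt_md|le_dm] := ltnP m d.
  rewrite (invfact_neg _ _ lt_md) !(mulr0, mul0r) big1 ?mulr0// => i _.
  rewrite [linearization R m n _]linearization_small ?mulr0 ?mul0r//.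
  by rewrite (leq_trans lt_md (leq_addl _ _)).
have [lt_nd|le_dn] := ltnP n d.
  rewrite (invfact_neg _ _ lt_nd) !(mulr0, mul0r) big1 ?mulr0// => i _.
  rewrite [linearization R m n _]linearization_small ?mulr0 ?mul0r//.
  by rewrite (leq_trans lt_nd (leq_addl _ _)) orbT.
rewrite !subzn//.
have [v def_v] : exists v, (m = d + v)%N by exists (m - d)%N; lia.
have [u def_u] : exists u, (n = d + u)%N by exists (n - d)%N; lia.
have kpuv : (k + p = u + v)%N by lia.
rewrite def_v def_u !addKn.
have -> : ((k + p + (d + v) + (d + u)) %/ 2 = u + v + d)%N by lia.
(* Cutting at the upper parameter [-p] gives the range of the single sum. *)
rewrite (@hyper_terminating _ _ _ p) ?inE ?eqxx ?orbT//.
rewrite -!mulrA; congr (_ * _); rewrite !mulr_sumr; apply: eq_bigr => i _.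
have le_ip := ltn_ord i; rewrite ltnS in le_ip.
by rewrite !rmorphN /= -(E4_summand k p d u v i kpuv le_ip) !mulrA.
Qed.

Lemma D4_E4 k p m n : D4 R k p m n = E4 R m n k p.
Proof.
rewrite /D4 /E4.
rewrite (_ : p + k + m + n = m + n + k + p)%N; last by lia.
rewrite (_ : k%:Z + p%:Z - m%:Z - n%:Z = k%:Z + p%:Z - n%:Z - m%:Z); last by lia.
rewrite (_ : p%:Z + k%:Z - m%:Z - n%:Z = k%:Z + p%:Z - n%:Z - m%:Z); last by lia.
rewrite (_ : p%:Z - k%:Z - m%:Z - n%:Z = p%:Z - k%:Z - n%:Z - m%:Z); last by lia.
rewrite (_ : k%:Z - p%:Z - m%:Z - n%:Z = k%:Z - p%:Z - n%:Z - m%:Z); last by lia.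
by rewrite (addnC m n).
Qed.

(** For [i <= p] the index [k + p - 2 * i] is at least [k - p], hence exceeds [m + n]. *)
Lemma gauss4_large k p m n : (m + n + p < k)%N -> gauss4 R k p m n = 0.
Proof.
move=> lt_k; rewrite gauss4_sum big1 // => i _; rewrite big1 // => j _.
case: eqP => [E|_]; last by rewrite mul0r mulr0.
by have := ltn_ord i; lia.
Qed.

Lemma F4nat_gauss4 k p m n : F4nat R k p m n = Num.sqrt pi * gauss4 R k p m n.
Proof.
rewrite /F4nat; case: ifPn => [odd_s|even_s]; first by rewrite gauss4_odd ?mulr0.
case: ifPn => [le_k|lt_k]; first by rewrite E4_gauss4//; lia.
case: ifPn => [/andP[ge_k le_k]|nk].
  by rewrite D4_E4 E4_gauss4 1?gauss4C //; lia.
(* Parity excludes [k = m + n - p + 1], so here [k > m + n + p]. *)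
by rewrite gauss4_large ?mulr0//; lia.
Qed.

(* At [n = 0] the value [G (-1)] is irrelevant, being multiplied by [n]. *)
Lemma three_term_of_hermite (G : int -> R) (c : R) (f : {poly R}) n :
  (forall j, G j%:Z = c * gauss R (hermite R j * f)) ->
  G (n%:Z + 1) + 2 * n%:R * G (n%:Z - 1) =
  c * (2 * gauss R ('X * (hermite R n * f))).
Proof.
move=> defG.
have -> : 2 * n%:R * G (n%:Z - 1) = 2 * n%:R * G n.-1.
  case: n => [|n]; first by rewrite mulr0 !mul0r.
  by rewrite intS addrC addKr.
rewrite -PoszD addn1 !defG mulrCA -mulrDr; congr (_ * _).
rewrite -natrM -!linearZ -linearD /=; congr (gauss _ _).
by rewrite -hermiteS scalerAl -mulrDl hermite_recurrence -scalerAl mulrA.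
Qed.

Lemma F4_gauss k p m n : F4 R k p m n =
  Num.sqrt pi * gauss R (hermite R k * hermite R p * hermite R m * hermite R n).
Proof. by rewrite [LHS]F4nat_gauss4 /gauss4 mulrA. Qed.

(** [X] is symmetric in the four indices; each equation varies one index and takes the product of
    the other three polynomials as [f]. *)
Lemma F4_recurrence k p m n (F := F4 R)
    (X := Num.sqrt pi *
      (2 * gauss R ('X * (hermite R k * hermite R p * hermite R m * hermite R n)))) :
  [/\ F (k%:Z + 1) p m n + 2 * k%:R * F (k%:Z - 1) p m n = X,
      F k (p%:Z + 1) m n + 2 * p%:R * F k (p%:Z - 1) m n = X,
      F k p (m%:Z + 1) n + 2 * m%:R * F k p (m%:Z - 1) n = X &
      F k p m (n%:Z + 1) + 2 * n%:R * F k p m (n%:Z - 1) = X].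
Proof.
(* Only the integral formula and the three-term relation are kept; the polynomials become atoms for
   [ring]. *)
rewrite /X /F; move: (hermite R) F4_gauss (three_term_of_hermite) => H FH recH.
split.
- rewrite (recH (fun z => F4 R z p m n) (Num.sqrt pi) (H p * H m * H n)).
    by rewrite !mulrA.
  by move=> j; rewrite FH !mulrA.
- rewrite (recH (fun z => F4 R k z m n) (Num.sqrt pi) (H k * H m * H n)).
    by congr (_ * (_ * gauss R _)); ring.
  by move=> j; rewrite FH; congr (_ * gauss R _); ring.
- rewrite (recH (fun z => F4 R k p z n) (Num.sqrt pi) (H k * H p * H n)).
    by congr (_ * (_ * gauss R _)); ring.
  by move=> j; rewrite FH; congr (_ * gauss R _); ring.
- rewrite (recH (fun z => F4 R k p m z) (Num.sqrt pi) (H k * H p * H m)).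
    by congr (_ * (_ * gauss R _)); ring.
  by move=> j; rewrite FH; congr (_ * gauss R _); ring.
Qed.

End Hypergeometric.

Theorem theorem5p6 (R : realType) (k p m n : nat)
    (hpm : (p <= m)%N) (hmn : (m <= n)%N) (hk : (k <= p + m + n)%N) :
  let F : int -> int -> int -> int -> R := @F4 R in
  let k' := k%:Z in let p' := p%:Z in let m' := m%:Z in let n' := n%:Z in
  (F k' p' (m' + 1) n' - F k' (p' + 1) m' n'
     + 2 * m%:R * F k' p' (m' - 1) n' - 2 * p%:R * F k' (p' - 1) m' n' = 0) /\
  (F k' p' m' (n' + 1) - F k' (p' + 1) m' n'
     + 2 * n%:R * F k' p' m' (n' - 1) - 2 * p%:R * F k' (p' - 1) m' n' = 0) /\
  (F (k' + 1) p' m' n' - F k' (p' + 1) m' n'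
     + 2 * k%:R * F (k' - 1) p' m' n' - 2 * p%:R * F k' (p' - 1) m' n' = 0) /\
  (F k' p' m' (n' + 1) - F k' p' (m' + 1) n'
     + 2 * n%:R * F k' p' m' (n' - 1) - 2 * m%:R * F k' p' (m' - 1) n' = 0) /\
  (F (k' + 1) p' m' n' - F k' p' (m' + 1) n'
     + 2 * k%:R * F (k' - 1) p' m' n' - 2 * m%:R * F k' p' (m' - 1) n' = 0) /\
  (F (k' + 1) p' m' n' - F k' p' m' (n' + 1)
     + 2 * k%:R * F (k' - 1) p' m' n' - 2 * n%:R * F k' p' m' (n' - 1) = 0).
Proof.
have [rk rp rm rn] := F4_recurrence R k p m n.
have cancel (a b c d x : R) : a + c = x -> b + d = x -> a - b + c - d = 0.
  by lra.
by do !split; apply: cancel; first [exact: rk | exact: rp | exact: rm | exact: rn].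
Qed.
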